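(* For any function $F:\mathbb{N}\to(0,\infty)$ with $F(n)\to\infty$ as $n\to\infty$ there exists a finitely generated group $G$ such that for any simple random walk $(G,\mu)$ on $G$ the radius of almost invariance is not bounded, and $r_{\rm a.i.}(n)\preceq F(n)$.
   Context: Let $G$ be a group generated by a finite set $S$, let $l_{G,S}$ be the word length, and let $\mu$ be a probability measure on $G$ with convolution powers $\mu^{*n}$. A simple random walk on $G$ is a random walk $(G,\mu)$ with $\mu$ symmetric, finitely supported, non-degenerate (its support generates $G$) and aperiodic (the greatest common divisor of the $K\ge 1$ with $\mu^{*K}(e)>0$ is $1$). For $r:\mathbb{N}\to[0,\infty)$, the random walk $(G,\mu)$ has almost invariant distributions on the scale $r(n)$ if for every $\epsilon>0$ and all sufficiently large $n$ there is a subset $V_{\epsilon,n}\subset G$ with $\mu^{*n}(V_{\epsilon,n})\ge 1-\epsilon$ such that for all $h\in V_{\epsilon,n}$ and all $g\in G$ with $l_{G,S}(g)\le r(n)$ one has $\mu^{*n}(h)>0$ and $|\mu^{*n}(hg)/\mu^{*n}(h)-1|\le\epsilon$. $r_{\rm a.i.}(n)\preceq r(n)$ means: for any function $r'(n)$ such that $r'(n)/r(n)$ tends to infinity on some subsequence, $(G,\mu)$ does not have almost invariant distributions on the scale $r'(n)$. The radius of almost invariance is not bounded means: there is an unbounded function $r(n)$ such that $(G,\mu)$ has almost invariant distributions on the scale $r(n)$. *)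

(* Defs.v *)
From HB Require Import structures.
From mathcomp Require Import all_boot all_order all_algebra.
From mathcomp Require Import all_classical all_reals all_analysis.
Import Order.TTheory GRing.Theory Num.Theory.
Import numFieldNormedType.Exports.

Set Implicit Arguments.
Unset Strict Implicit.
Unset Printing Implicit Defensive.

Local Open Scope classical_set_scope.
Local Open Scope ring_scope.

(* Groups are arbitrary, possibly infinite: groupType, not finGroupType. *)
Definition spells (G : groupType) (S : set G) (g : G) (w : seq G) : Prop :=
  (forall s, s \in w -> S s \/ S (s^-1)%g) /\ (\prod_(s <- w) s)%g = g.

Definition generates (G : groupType) (S : set G) : Prop :=
  forall g, exists w, spells S g w.

Definition finitely_generated (G : groupType) : Prop :=
  exists S : set G, finite_set S /\ generates S.

(* The default value 0 is only taken when g is not in the subgroup generated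
   by S. *)
Definition word_length (G : groupType) (S : set G) (g : G) : nat :=
  xget 0%N [set n | (exists w, spells S g w /\ size w = n) /\
                    (forall w, spells S g w -> (n <= size w)%N)].

(* A probability measure on a discrete group is given by its mass function. *)
Definition measure_of (R : realType) (G : groupType) (mu : G -> R)
  (V : set G) : \bar R := \esum_(g in V) (mu g)%:E.

Definition is_probability (R : realType) (G : groupType) (mu : G -> R) : Prop :=
  (forall g, 0 <= mu g) /\ measure_of mu [set: G] = 1%:E.

(* For probability mass functions the sum is finite, so fine is harmless. *)
Definition convolution (R : realType) (G : groupType) (mu nu : G -> R)
  (g : G) : R := fine (\esum_(h in [set: G]) (mu h * nu (h^-1 * g)%g)%:E).

Definition point_mass (R : realType) (G : groupType) (a g : G) : R :=
  (g == a)%:R.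

Definition convolution_power (R : realType) (G : groupType) (mu : G -> R)
  (n : nat) : G -> R := iter n (convolution mu) (point_mass R 1%g).

Definition is_gcd (A : set nat) (d : nat) : Prop :=
  (forall k, A k -> (d %| k)%N) /\
  (forall e, (forall k, A k -> (e %| k)%N) -> (e %| d)%N).

Definition support_of (R : realType) (G : groupType) (mu : G -> R) : set G :=
  [set g | 0 < mu g].

Definition aperiodic (R : realType) (G : groupType) (mu : G -> R) : Prop :=
  is_gcd [set k | (1 <= k)%N /\ 0 < convolution_power mu k 1%g] 1%N.

Definition simple_random_walk (R : realType) (G : groupType) (mu : G -> R)
  : Prop :=
  [/\ is_probability mu,
      forall g, mu (g^-1)%g = mu g,
      finite_set (support_of mu),
      generates (support_of mu) &
      aperiodic mu].

Definition almost_invariant (R : realType) (G : groupType) (S : set G)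
  (mu : G -> R) (r : nat -> R) : Prop :=
  forall eps : R, 0 < eps -> \forall n \near \oo,
    exists V : set G,
      ((1 - eps)%:E <= measure_of (convolution_power mu n) V)%E /\
      forall h g : G, V h -> (word_length S g)%:R <= r n ->
        0 < convolution_power mu n h /\
        `|convolution_power mu n (h * g)%g / convolution_power mu n h - 1|
          <= eps.

Definition infinite_on_subsequence (R : realType) (u : nat -> R) : Prop :=
  exists phi : nat -> nat,
    {homo phi : m n / (m < n)%N >-> (m < n)%N} /\
    u (phi k) @[k --> \oo] --> +oo.

Definition radius_ai_preceq (R : realType) (G : groupType) (S : set G)
  (mu : G -> R) (r : nat -> R) : Prop :=
  forall r' : nat -> R, (forall n, 0 <= r' n) ->
    infinite_on_subsequence (fun n => r' n / r n) ->
    ~ almost_invariant S mu r'.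

Definition radius_ai_not_bounded (R : realType) (G : groupType) (S : set G)
  (mu : G -> R) : Prop :=
  exists r : nat -> R,
    [/\ forall n, 0 <= r n,
        forall M : R, exists n, M < r n &
        almost_invariant S mu r].

(* Main.v *)
From HB Require Import structures.
Require Import Defs.
From mathcomp Require Import all_boot all_order all_algebra perm.
From mathcomp Require Import all_classical all_reals all_analysis.
From mathcomp Require Import ring lra zify.
Import Order.TTheory GRing.Theory Num.Theory.
Import numFieldNormedType.Exports.
Local Open Scope classical_set_scope.
Local Open Scope ring_scope.

Set Implicit Arguments.
Unset Strict Implicit.
Unset Printing Implicit Defensive.

(** Why the statement is true.

    The group.  Let X_k be the finite set of words of length at most N k in
    three letters.  Removing or prepending a letter x (when possible) is an
    involution [flip x] of X_k; away from the longest words, the three flips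
    act on reduced words like the generators of the free product of three
    groups of order two.  Let G be the subgroup of the semidirect product of
    Z with the product over k of all maps from Z to Sym(X_k) that is generated
    by the shift of Z and by three switches, where the switch x puts [flip x]
    in every coordinate k, at the site x * k of Z.  The function N is chosen
    at the end, growing as fast as F forces it to.

    The radius is at most F.  Conjugating the switches by powers of the shift
    gives three elements of length O(k) which, in the coordinate k, act on the
    lamp at the site 0 by the three flips.  Evaluating this lamp at the empty
    word maps G to X_k, and turns right multiplication by these elements into
    the flips.  The law at time n only charges words of length at most rho n,
    hence, if rho n < N k, the flip x sends every word in play that does not
    start with x to one that does.  So a law that is almost invariant under
    the three elements gives mass almost 1/2 to each of the three disjoint
    events that the word starts with a given letter, which is absurd
    ([no_invariant_mass]).  With k the integer part of F n and N k > k n, this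
    excludes the scales that are large compared with F.

    The radius is not bounded.  Write X_n for the position of the walk.  It is
    enough that, for each y, the laws of X_n y and X_n become close in total
    variation; [defect y] is the limit of their distances, and it is
    subharmonic along the walk z y z^-1 on the conjugacy class of y.  If it
    attains its maximum over the class at y, it vanishes there: some power of
    mu has a component that is uniform on 1, y, ..., y^(j-1), and this uniform
    law is moved by at most 2/j under y ([defect_max0]).  To get a maximum,
    project G to Z: the supremum of the defect over the conjugates by elements
    of a given degree is a bounded subharmonic function on Z, hence constant,
    because Z is recurrent ([bounded_subharmonic_const]).  It is therefore
    enough to know finitely many values over the degree 0, and this may be
    read modulo elements already known to be harmless
    ([tame_of_finite_fiber]).  This is applied three times: to the elements
    with finitely many nontrivial lamps; to the switches, since a switch and a
    fixed element of degree 0 commute in all but finitely many coordinates,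
    the three sites 0, k and 2k being far apart; and to the shift, which is
    central modulo the conjugates of the switches. *)

(** * Expectations along the walk *)

Section Expectation.
Variables (R : realType) (G : groupType) (mu : G -> R) (D : seq G).

(** The expectation of [f] at the position of the walk at time [n], when [mu]
    is carried by the list [D].  Working with this functional instead of the
    measure keeps all sums finite. *)
Fixpoint expect n (f : G -> R) : R :=
  if n is n'.+1 then \sum_(s <- D) mu s * expect n' (fun x => f (s * x)%g)
  else f 1%g.

Definition law n g := expect n (fun x => (x == g)%:R).

Fixpoint reach n : seq G :=
  if n is n'.+1 then undup (allpairs (fun s x => s * x)%g D (reach n'))
  else [:: 1%g].

Lemma expectD n f f' :
  expect n (fun x => f x + f' x) = expect n f + expect n f'.
Proof.
elim: n f f' => [//|n IHn] f f' /=; rewrite -big_split /=.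
by apply: eq_bigr => s _; rewrite IHn mulrDr.
Qed.

Lemma expectZ n (c : R) f : expect n (fun x => c * f x) = c * expect n f.
Proof.
elim: n f => [//|n IHn] f /=; rewrite mulr_sumr.
by apply: eq_bigr => s _; rewrite IHn mulrCA.
Qed.

Lemma expectB n f f' :
  expect n (fun x => f x - f' x) = expect n f - expect n f'.
Proof.
rewrite expectD; congr (_ + _); rewrite -[RHS]mulN1r -expectZ.
by congr expect; apply/funext => x; rewrite mulN1r.
Qed.

Lemma expect_sum n (I : Type) (l : seq I) (f : I -> G -> R) :
  expect n (fun x => \sum_(i <- l) f i x) = \sum_(i <- l) expect n (f i).
Proof.
elim: l => [|i l IHl].
  rewrite big_nil -[RHS](mul0r (expect n (fun=> 0))) -expectZ.
  by congr expect; apply/funext => x; rewrite big_nil mul0r.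
rewrite big_cons -IHl -expectD.
by congr expect; apply/funext => x; rewrite big_cons.
Qed.

Lemma expect_add m n f :
  expect (m + n) f = expect m (fun x => expect n (fun z => f (x * z)%g)).
Proof.
elim: m f => [|m IHm] f /=.
  by congr expect; apply/funext => z; rewrite mul1g.
apply: eq_bigr => s _; rewrite IHm; congr (_ * expect _ _).
by apply/funext => x; congr expect; apply/funext => z; rewrite mulgA.
Qed.

Lemma reach_uniq n : uniq (reach n).
Proof. by case: n => //= n; apply: undup_uniq. Qed.

Lemma reachS n s x : s \in D -> x \in reach n -> (s * x)%g \in reach n.+1.
Proof. by move=> sD xn; rewrite mem_undup; apply: allpairs_f. Qed.

Lemma delta_sum (l : seq G) (F : G -> R) x : uniq l ->
  \sum_(h <- l) F h * (x == h)%:R = (x \in l)%:R * F x.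
Proof.
move=> ul; case: (boolP (x \in l)) => xl.
  rewrite (bigD1_seq x) //= eqxx mulr1 mul1r big1 ?addr0// => h.
  by rewrite eq_sym => /negPf ->; rewrite mulr0.
rewrite mul0r big1_seq // => h /andP[_ hl].
by case: eqP => [xh|]; rewrite ?mulr0//; rewrite xh hl in xl.
Qed.

Lemma eq_expect (A : nat -> G -> Prop) n f f' :
  A 0%N 1%g -> (forall n s x, s \in D -> A n x -> A n.+1 (s * x)%g) ->
  (forall x, A n x -> f x = f' x) -> expect n f = expect n f'.
Proof.
move=> A0 AS; elim: n f f' => [|n IHn] f f' ff' /=; first exact: ff'.
apply: eq_big_seq => s sD; congr (_ * _); apply: IHn => x Ax.
by apply: ff'; apply: AS.
Qed.

(** On the finite set of reachable points [f] is a combination of Dirac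
    functions, so linearity suffices. *)
Lemma expectE n f : expect n f = \sum_(x <- reach n) law n x * f x.
Proof.
rewrite (@eq_expect (fun n x => x \in reach n) n f
  (fun x => \sum_(h <- reach n) f h * (x == h)%:R)); first last.
- by move=> x xn; rewrite delta_sum ?reach_uniq// xn mul1r.
- exact: reachS.
- by rewrite inE.
by rewrite expect_sum; apply: eq_bigr => h _; rewrite expectZ mulrC.
Qed.

Lemma lawS n g : law n.+1 g = \sum_(s <- D) mu s * law n (s^-1 * g)%g.
Proof.
apply: eq_bigr => s _; congr (_ * expect _ _); apply/funext => x.
by congr ((_ : bool)%:R); apply/eqP/eqP => [<-|->]; rewrite ?mulKg ?mulVKg.
Qed.

Hypothesis mu_ge0 : forall s, 0 <= mu s.

Lemma expect_le n f f' : (forall x, f x <= f' x) -> expect n f <= expect n f'.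
Proof.
elim: n f f' => [|n IHn] f f' ff' //=.
by apply: ler_sum => s _; apply: ler_wpM2l => //; apply: IHn.
Qed.

Lemma law_ge0 n g : 0 <= law n g.
Proof.
have -> : 0 = expect n (fun=> 0).
  rewrite -[LHS](mul0r (expect n (fun=> 0))) -expectZ.
  by congr expect; apply/funext => x; rewrite mul0r.
by apply: expect_le => x.
Qed.

Lemma law_le n g f : (forall x, 0 <= f x) -> law n g * f g <= expect n f.
Proof.
move=> f0; rewrite mulrC -expectZ; apply: expect_le => x.
by case: eqP => [->|]; rewrite ?mulr1 // mulr0.
Qed.

Lemma law_notin n g : g \notin reach n -> law n g = 0.
Proof.
move=> gn; have -> : law n g = expect n (fun=> 0).
  apply: (@eq_expect (fun n x => x \in reach n)).
  - by rewrite inE.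
  - exact: reachS.
  by move=> x xn; case: eqP => // xg; rewrite -xg xn in gn.
by rewrite expectE big1 // => x _; rewrite mulr0.
Qed.

Lemma expect_cvg n (f : nat -> G -> R) (f' : G -> R) :
  (forall x, f k x @[k --> \oo] --> f' x) ->
  expect n (f k) @[k --> \oo] --> expect n f'.
Proof.
move=> ff'; rewrite expectE; under eq_fun do rewrite expectE.
apply: cvg_big => [|x _]; first exact: add_continuous.
by apply: cvgM => //; apply: cvg_cst.
Qed.

End Expectation.

(** A simple random walk, in the form in which it is used: the support is
    listed, generation is an induction principle, and aperiodicity says that
    every element is charged at all large times. *)
Record walk_on (R : realType) (G : groupType) (mu : G -> R) (D : seq G)
  : Prop := WalkOn {
  walk_ge0 : forall s, 0 <= mu s;
  walk_uniq : uniq D;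
  walk_supp : forall s, (s \in D) = (0 < mu s);
  walk_total : \sum_(s <- D) mu s = 1;
  walk_sym : forall s, mu s^-1%g = mu s;
  walk_perm : perm_eq [seq s^-1%g | s <- D] D;
  walk_gen : forall P : G -> Prop, P 1%g ->
    (forall s x, s \in D -> P x -> P (s * x)%g) -> forall g, P g;
  walk_law_gt0 : forall y : G, \forall K \near \oo, 0 < law mu D K y }.

(** * The asymptotic defect of invariance *)

Section Oscillation.
Variables (R : realType) (G : groupType) (mu : G -> R) (D : seq G).
Hypothesis mu_ge0 : forall s, 0 <= mu s.
Hypothesis mu_total : \sum_(s <- D) mu s = 1.

Local Notation E := (expect mu D).

Lemma expect_cst n c : E n (fun=> c) = c.
Proof. by elim: n => //= n ->; rewrite -mulr_suml mu_total mul1r. Qed.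

(** The last [n] steps are singled out here, whereas [expect_add] singles out
    the first [m]: convolution powers commute. *)
Lemma expect_addC m n f :
  E (m + n) f = E n (fun z => E m (fun x => f (x * z)%g)).
Proof.
rewrite expect_add [RHS]expectE.
under [RHS]eq_bigr => z _ do rewrite -expectZ.
rewrite -expect_sum; congr expect; apply/funext => x.
exact: expectE.
Qed.

Lemma expect_norm n f c : (forall x, `|f x| <= c) -> `|E n f| <= c.
Proof.
move=> fc; rewrite ler_norml -{1}(expect_cst n (- c)) -{2}(expect_cst n c).
by apply/andP; split; apply: expect_le => // x; have := fc x;
  rewrite ler_norml => /andP[].
Qed.

Definition bias n y f := E n (fun x => f (x * y)%g) - E n f.

(** This is the l^1 distance between the laws of X_n and X_n y, by duality
    between l^1 and the bounded functions. *)
Definition osc n y :=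
  sup [set bias n y f | f in [set f | forall x, `|f x| <= 1]].

Lemma bias_le2 n y f : (forall x, `|f x| <= 1) -> bias n y f <= 2.
Proof.
move=> f1; have := expect_norm n f1.
have := @expect_norm n (fun x => f (x * y)%g) 1 (fun x => f1 _).
by rewrite /bias !ler_norml => /andP[_ h1] /andP[h2 _]; lra.
Qed.

Lemma bias_le_osc n y f : (forall x, `|f x| <= 1) -> bias n y f <= osc n y.
Proof.
move=> f1; apply: ub_le_sup; last by exists f.
by exists 2 => _ [g g1 <-]; apply: bias_le2.
Qed.

Lemma osc_le n y c :
  (forall f, (forall x, `|f x| <= 1) -> bias n y f <= c) -> osc n y <= c.
Proof.
move=> fc; apply: ge_sup; last by move=> _ [f f1 <-]; apply: fc.
by exists (bias n y (fun=> 0)), (fun=> 0) => // x; rewrite normr0.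
Qed.

Lemma osc_le2 n y : osc n y <= 2.
Proof. by apply: osc_le => f; apply: bias_le2. Qed.

Lemma osc_ge0 n y : 0 <= osc n y.
Proof.
have <- : bias n y (fun=> 0) = 0 by rewrite /bias subrr.
by apply: bias_le_osc => x; rewrite normr0.
Qed.

Lemma osc1 n : osc n 1%g = 0.
Proof.
apply/eqP; rewrite eq_le osc_ge0 andbT; apply: osc_le => f _.
rewrite /bias; under eq_fun do rewrite mulg1.
by rewrite subrr.
Qed.

Lemma oscM n y z : osc n (y * z)%g <= osc n y + osc n z.
Proof.
apply: osc_le => f f1.
have h1 := @bias_le_osc n y (fun x => f (x * z)%g) (fun x => f1 _).
have h2 := @bias_le_osc n z f f1.
apply: le_trans (lerD h1 h2); rewrite /bias.
under [X in expect _ _ _ X - _ + _]eq_fun do rewrite -mulgA.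
by lra.
Qed.

Lemma oscV n y : osc n y^-1%g <= osc n y.
Proof.
apply: osc_le => f f1.
have h1 := @bias_le_osc n y (fun x => (-1) * f (x * y^-1)%g).
apply: le_trans (h1 _); last by move=> x; rewrite mulN1r normrN.
rewrite /bias !expectZ.
have -> : (fun x => f (x * y / y)%g) = f by apply/funext => x; rewrite mulgK.
by lra.
Qed.

Lemma bias_add n K y f :
  bias (n + K) y f =
  E K (fun z => bias n (z * y * z^-1)%g (fun x => f (x * z)%g)).
Proof.
rewrite /bias !expect_addC expectB; congr (_ - _).
congr expect; apply/funext => z; congr expect; apply/funext => x.
by rewrite !mulgA mulgVK.
Qed.

(** Moving y across the last [K] steps z replaces it by z y z^-1. *)
Lemma osc_add n K y :
  osc (n + K) y <= E K (fun z => osc n (z * y * z^-1)%g).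
Proof.
apply: osc_le => f f1; rewrite bias_add; apply: expect_le => // z.
by apply: bias_le_osc => x.
Qed.

Lemma osc_noninc y : nonincreasing_seq (osc ^~ y).
Proof.
apply/nonincreasing_seqP => n; apply: osc_le => f f1.
rewrite /bias -add1n !expect_add -expectB -[leRHS](expect_cst 1).
apply: expect_le => // z.
under [X in expect _ _ _ X - _]eq_fun do rewrite -mulgA.
exact: (@bias_le_osc n y (fun x => f (z * x)%g)).
Qed.

(** The limit exists since one more step on the left only decreases the
    distance ([osc_noninc]). *)
Definition defect y : R := limn (osc ^~ y).

Lemma defect_cvg y : osc n y @[n --> \oo] --> defect y.
Proof.
apply: nonincreasing_is_cvgn (osc_noninc y) _.
by exists 0 => _ [n _ <-]; apply: osc_ge0.
Qed.

Lemma defect_le2 y : defect y <= 2.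
Proof.
by apply: (cvgr_to_le (@defect_cvg y)); apply: nearW => n; apply: osc_le2.
Qed.

Lemma defect_ge0 y : 0 <= defect y.
Proof.
by apply: (cvgr_to_ge (@defect_cvg y)); apply: nearW => n; apply: osc_ge0.
Qed.

Lemma defect1 : defect 1%g = 0.
Proof.
rewrite /defect; under eq_fun do rewrite osc1.
exact: (cvg_lim (@Rhausdorff R) (cvg_cst _)).
Qed.

Lemma defectM y z : defect (y * z)%g <= defect y + defect z.
Proof.
apply: (ler_cvg_to (@defect_cvg _) (cvgD (@defect_cvg y) (@defect_cvg z))).
by apply: nearW => n; apply: oscM.
Qed.

Lemma defectV y : defect y^-1%g <= defect y.
Proof.
apply: (ler_cvg_to (@defect_cvg _) (@defect_cvg y)).
by apply: nearW => n; apply: oscV.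
Qed.

Lemma defect_addK K y : osc (n + K) y @[n --> \oo] --> defect y.
Proof. by have := @defect_cvg y; rewrite -(cvg_shiftn K). Qed.

Lemma defect_subharmonic K y :
  defect y <= E K (fun z => defect (z * y * z^-1)%g).
Proof.
apply: (ler_cvg_to (@defect_addK K y)).
  by apply: expect_cvg => x; apply: defect_cvg.
by apply: nearW => n; apply: osc_add.
Qed.

Lemma defect_eqM y z : defect z = 0 -> defect (z * y)%g = defect y.
Proof.
move=> z0; apply/eqP; rewrite eq_le; apply/andP; split.
  by have := defectM z y; rewrite z0 add0r.
by have := defectM z^-1%g (z * y)%g; have := defectV z; rewrite mulKg; lra.
Qed.

Hypothesis law_gt0 : forall y : G, \forall K \near \oo, 0 < law mu D K y.

(** Isolates a multiple [b] of the counting measure of [l] inside the law at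
    time [K].  The factor [size l] allows for repetitions in [l]: the powers of
    an element of finite order may coincide. *)
Lemma expect_ge_sum K u (l : seq G) b :
  (forall x, 0 <= u x) ->
  (forall x, x \in l -> b *+ size l <= law mu D K x) ->
  b * \sum_(x <- l) u x <= E K u.
Proof.
move=> u0 bl; have [->|l0] := eqVneq l [::].
  by rewrite big_nil mulr0 -(expect_cst K 0); apply: expect_le.
have sl : 0 < (size l)%:R :> R by rewrite ltr0n lt0n size_eq0.
rewrite -(ler_pM2l sl) mulrA [_ * b]mulrC mulr_natr mulr_sumr.
have -> : (size l)%:R * E K u = \sum_(x <- l) E K u.
  by rewrite big_const_seq count_predT iter_addr_0 mulr_natl.
rewrite big_seq [leRHS]big_seq; apply: ler_sum => x xl.
apply: le_trans (@law_le R G mu D mu_ge0 K x u u0); apply: ler_wpM2r => //.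
exact: bl.
Qed.

(** The law at some time [K] dominates [b] times the sum of the Dirac masses at
    y^0, ..., y^j.  On this part of the law the translation by y telescopes, so
    that it contributes at most 2 b instead of b (j + 1) times the defect of y;
    on the rest the defects of the conjugates are at most that of y.  Comparing
    the two sides leaves (j + 1) * defect y <= 2, for every j. *)
Lemma defect_max0 y :
  (forall z, defect (z * y * z^-1)%g <= defect y) -> defect y = 0.
Proof.
move=> ymax.
suff bound j : j%:R * defect y <= 2.
  apply/eqP; rewrite eq_le defect_ge0 andbT leNgt; apply/negP => y0.
  have := bound (Num.truncn (3 / defect y)).+1.
  have := truncnS_gt (3 / defect y).
  by rewrite ltr_pdivrMr// => h1 h2; lra.
case: j => [|j]; first by rewrite mul0r.
pose l := [seq (y ^+ i)%g | i <- iota 0 j.+1].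
have [K Kl] : exists K, forall x, x \in l -> 0 < law mu D K x.
  have : \forall K \near \oo, forall x, x \in l -> 0 < law mu D K x.
    elim: l => [|x l IHl]; first by apply: nearW.
    apply: filterS2 (law_gt0 x) IHl => K Kx Kl z.
    by rewrite inE => /orP[/eqP ->//|]; apply: Kl.
  by move=> /filter_ex[K]; exists K.
have [c c0 cl] : exists2 c : R, 0 < c & forall x, x \in l -> c <= law mu D K x.
  elim: l Kl => [|x l IHl] Kl; first by exists 1.
  have [z zl|c c0 cl] := IHl; first by apply: Kl; rewrite inE zl orbT.
  exists (Num.min c (law mu D K x)).
    by rewrite lt_min c0 Kl// mem_head.
  move=> z; rewrite inE => /orP[/eqP ->|/cl cz]; rewrite ge_min ?lexx ?orbT//.
  by rewrite cz.
have sl : size l = j.+1 by rewrite size_map size_iota.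
pose b := c / j.+1%:R; have b0 : 0 < b by rewrite divr_gt0.
have step n : osc (n + K) y <= E K (fun z => osc n (z * y * z^-1)%g)
    - b * (j.+1%:R * osc n y) + b * 2.
  apply: osc_le => f f1; rewrite bias_add.
  set H := fun z => bias _ _ _.
  have := @expect_ge_sum K (fun z => osc n (z * y * z^-1)%g - H z) l b.
  rewrite expectB => /(_ _ _)/wrap[z|x xl|].
  - by rewrite subr_ge0; apply: bias_le_osc.
  - by rewrite sl -[X in X <= _]mulr_natr /b divfK ?pnatr_eq0//; apply: cl.
  rewrite big_map big_split sumrN /=.
  have -> : \sum_(i <- iota 0 j.+1) H (y ^+ i)%g = bias n (y ^+ j.+1)%g f.
    rewrite -[iota 0 j.+1]/(index_iota 0 j.+1).
    pose e i := E n (fun x => f (x * y ^+ i)%g).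
    transitivity (e j.+1 - e 0%N).
      rewrite -telescope_sumr//; apply: eq_bigr => i _; rewrite /H /bias /e.
      congr (_ - _); congr expect; apply/funext => x.
      by rewrite !mulgA mulgVK -mulgA -expgSr.
    rewrite /e /bias; congr (_ - _); congr expect.
    by apply/funext => x; rewrite expg0 mulg1.
  have -> : \sum_(i <- iota 0 j.+1) osc n (y ^+ i * y * (y ^+ i)^-1)%g =
      j.+1%:R * osc n y.
    under eq_bigr => i _ do rewrite -expgSr expgS mulgK.
    by rewrite big_const_seq count_predT iter_addr_0 size_iota mulr_natl.
  have := ler_wpM2l (ltW b0) (bias_le2 n (y ^+ j.+1)%g f1).
  by rewrite [b * (_ * _ - _)]mulrBr; lra.
have : defect y <= E K (fun z => defect (z * y * z^-1)%g)
    - b * (j.+1%:R * defect y) + b * 2.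
  apply: (ler_cvg_to (@defect_addK K y));
    last by apply: nearW => n; apply: step.
  apply: cvgD; last exact: cvg_cst.
  apply: cvgB; first by apply: expect_cvg => x; apply: defect_cvg.
  apply: cvgM; first exact: cvg_cst.
  by apply: cvgM; [exact: cvg_cst|exact: defect_cvg].
have : E K (fun z => defect (z * y * z^-1)%g) <= defect y.
  by rewrite -[leRHS](expect_cst K); apply: expect_le.
move=> h1 h2; have : b * (j.+1%:R * defect y) <= b * 2 by lra.
by rewrite ler_pM2l.
Qed.

End Oscillation.

(** * Second differences on the integers *)

Section IntegerSums.
Variable R : realType.

(** Both sides are the sum of [w] over [0, L + d) minus its sums over [0, L) and
    [0, d). *)
Lemma sum_shift_sub (w : nat -> R) L d :
  \sum_(i < L) (w (i + d)%N - w i) = \sum_(i < d) (w (i + L)%N - w i).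
Proof.
have split_at a b :
    \sum_(i < a + b) w i = \sum_(i < a) w i + \sum_(i < b) w (a + i)%N.
  by rewrite big_split_ord.
rewrite !sumrB.
have := split_at L d; rewrite addnC split_at.
under [X in _ + X = _]eq_bigr do rewrite addnC.
under [X in _ = _ + X]eq_bigr do rewrite addnC.
by lra.
Qed.

(** As a function of (i, j) the summand is a mixed difference with steps d in
    both directions, so it telescopes twice and leaves d * d corner terms: a
    bound that does not depend on [L].  This is the recurrence of Z. *)
Lemma second_difference_sum (g : int -> R) (B : R) (m : int) (L d : nat) :
  (forall k, `|g k| <= B) ->
  `|\sum_(j < L) \sum_(i < L) (g (m + i%:Z - j%:Z + d%:Z)
      + g (m + i%:Z - j%:Z - d%:Z) - 2 * g (m + i%:Z - j%:Z))|
  <= (d * d)%:R * (4 * B).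
Proof.
move=> gB; pose F i j := g (m + i%:Z - j%:Z).
pose H j := \sum_(i < L) (F (i + d)%N j - F i j).
have HE j : H j = \sum_(i < d) (F (i + L)%N j - F i j).
  exact: (sum_shift_sub (F^~ j)).
have -> : \sum_(j < L) \sum_(i < L) (g (m + i%:Z - j%:Z + d%:Z)
      + g (m + i%:Z - j%:Z - d%:Z) - 2 * g (m + i%:Z - j%:Z))
    = - \sum_(j < L) (H (j + d)%N - H j).
  rewrite -sumrN; apply: eq_bigr => j _; rewrite /H -sumrB -sumrN.
  apply: eq_bigr => i _; rewrite /F.
  have -> : m + (i + d)%N%:Z - (j + d)%N%:Z = m + i%:Z - j%:Z by lia.
  have -> : m + (i + d)%N%:Z - j%:Z = m + i%:Z - j%:Z + d%:Z by lia.
  have -> : m + i%:Z - (j + d)%N%:Z = m + i%:Z - j%:Z - d%:Z by lia.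
  by ring.
rewrite normrN sum_shift_sub.
have -> : (d * d)%:R * (4 * B) = \sum_(j < d) \sum_(i < d) (4 * B).
  by rewrite !sumr_const !card_ord -mulrnA mulr_natl.
apply: le_trans (ler_norm_sum _ _ _) _; apply: ler_sum => j _.
rewrite !HE -sumrB.
apply: le_trans (ler_norm_sum _ _ _) _; apply: ler_sum => i _.
have Fb i' j' : - B <= F i' j' <= B by rewrite -ler_norml; apply: gB.
have /andP[a1 a2] := Fb (i + L)%N (j + L)%N.
have /andP[b1 b2] := Fb i (j + L)%N.
have /andP[c1 c2] := Fb (i + L)%N j.
have /andP[d1 d2] := Fb i j.
by rewrite ler_norml; apply/andP; split; lra.
Qed.

End IntegerSums.

(** * Recurrence of the integers and vanishing of the defect *)

Section Tameness.
Variable R : realType.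
Variables (G : groupType) (mu : G -> R) (D : seq G) (deg : G -> int).
Hypothesis mu_walk : walk_on mu D.
Hypothesis degM : forall x y, deg (x * y)%g = deg x + deg y.
Let mu_ge0 := walk_ge0 mu_walk.
Let mu_total := walk_total mu_walk.
Let mu_sym := walk_sym mu_walk.
Let D_sym := walk_perm mu_walk.
Let D_gen := walk_gen mu_walk.
Let law_gt0 := walk_law_gt0 mu_walk.

Lemma hom_deg1 : deg 1%g = 0.
Proof. by have := degM 1%g 1%g; rewrite mulg1 => h; lia. Qed.

Lemma hom_degV x : deg x^-1%g = - deg x.
Proof. by have := degM x x^-1%g; rewrite mulgV hom_deg1 => h; lia. Qed.

(** For [psi] subharmonic and nonnegative, the variance [v] of one step is at
    most the Laplacian of psi^2.  Summing over (i, j) in an L by L square, the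
    Laplacian gives a bounded total by [second_difference_sum], whereas the
    diagonal i = j alone gives L * v m.  Hence v m = 0. *)
Lemma bounded_subharmonic_const (psi : int -> R) (M : R) :
  (forall m, 0 <= psi m <= M) ->
  (forall m, psi m <= \sum_(s <- D) mu s * psi (m + deg s)) ->
  forall m s, s \in D -> psi (m + deg s) = psi m.
Proof.
move=> psiM sub m s sD; have mus : 0 < mu s by rewrite -(walk_supp mu_walk).
pose g m := psi m ^+ 2.
pose v m := \sum_(s <- D) mu s * (psi (m + deg s) - psi m) ^+ 2.
have v_ge0 k : 0 <= v k.
  by apply: sumr_ge0 => x _; rewrite mulr_ge0// sqr_ge0.
have gB k : `|g k| <= M ^+ 2.
  have /andP[p0 pM] := psiM k.
  by rewrite /g ger0_norm ?sqr_ge0// ler_sqr// nnegrE; lra.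
pose Lap d k := g (k + d) + g (k - d) - 2 * g k.
have v_le k : v k <= \sum_(s <- D) mu s * (Lap (deg s) k / 2).
  have -> : \sum_(s <- D) mu s * (Lap (deg s) k / 2)
      = \sum_(s <- D) mu s * g (k + deg s) - g k.
    have e1 : \sum_(s <- D) mu s * g (k - deg s) =
        \sum_(s <- D) mu s * g (k + deg s).
      rewrite -(perm_big _ D_sym) /= big_map.
      by apply: eq_bigr => x _; rewrite mu_sym hom_degV opprK.
    transitivity ((\sum_(s <- D) mu s * g (k + deg s)) / 2
        + (\sum_(s <- D) mu s * g (k - deg s)) / 2
        - (\sum_(s <- D) mu s) * g k).
      rewrite !mulr_suml -big_split -sumrB /=; apply: eq_bigr => x _.
      by rewrite /Lap; field.
    by rewrite e1 mu_total; field.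
  have -> : v k = \sum_(s <- D) mu s * g (k + deg s)
      - 2 * psi k * (\sum_(s <- D) mu s * psi (k + deg s))
      + (\sum_(s <- D) mu s) * g k.
    rewrite mulr_sumr mulr_suml -sumrB -big_split; apply: eq_bigr => x _ /=.
    by rewrite /g; ring.
  have /andP[p0 _] := psiM k.
  have := ler_wpM2l p0 (sub k); rewrite mu_total /g.
  set S1 := \sum_(_ <- _) _ * _ ^+ 2; set S2 := \sum_(_ <- _) _ => h.
  by rewrite -mulrA mul1r expr2; lra.
pose C : R :=
  \sum_(s <- D) mu s * ((`|deg s| * `|deg s|)%:R * (4 * M ^+ 2) / 2).
have bound L : L%:R * v m <= C.
  have : \sum_(j < L) \sum_(i < L) v (m + i%:Z - j%:Z) <= C.
    apply: (@le_trans _ _ (\sum_(j < L) \sum_(i < L) \sum_(s <- D)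
        mu s * (Lap (deg s) (m + i%:Z - j%:Z) / 2))).
      by apply: ler_sum => j _; apply: ler_sum => i _; apply: v_le.
    under eq_bigr => j _ do rewrite exchange_big /=.
    rewrite exchange_big /=; apply: ler_sum => x _.
    under eq_bigr => j _ do rewrite -mulr_sumr -mulr_suml.
    rewrite -mulr_sumr -mulr_suml; apply: ler_wpM2l => //.
    rewrite ler_pM2r ?invr_gt0//.
    apply: le_trans (ler_norm _) _.
    have [deg_pos|deg_neg] := leP 0 (deg x).
      have := @second_difference_sum R g (M ^+ 2) m L `|deg x|%N gB.
      by rewrite gez0_abs.
    have := @second_difference_sum R g (M ^+ 2) m L `|deg x|%N gB.
    rewrite ltz0_abs//; congr (`|_| <= _).
    apply: eq_bigr => j _; apply: eq_bigr => i _; rewrite /Lap opprK.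
    by rewrite [X in X - _]addrC.
  apply: le_trans.
  have -> : L%:R * v m = \sum_(j < L) v m.
    by rewrite sumr_const card_ord mulr_natl.
  apply: ler_sum => j _; rewrite (bigD1 j) //= addrK lerDl.
  exact: sumr_ge0.
have v0 : v m = 0.
  apply/eqP; rewrite eq_le v_ge0 andbT leNgt; apply/negP => vm.
  have := bound (Num.truncn (C / v m)).+1.
  by rewrite -ler_pdivlMr// leNgt truncnS_gt.
move: v0 => /eqP; rewrite psumr_eq0; last first.
  by move=> x _; rewrite mulr_ge0 ?sqr_ge0.
move=> /allP/(_ s sD) /=; rewrite mulf_eq0 gt_eqF//= expf_eq0/= subr_eq0.
by move/eqP.
Qed.

Local Notation defect := (defect mu D).

(** Asking for all conjugates makes the tame elements a normal subgroup. *)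
Definition tame h := forall u, defect (u * h * u^-1)%g = 0.

Lemma tame1 : tame 1%g.
Proof. by move=> u; rewrite mulg1 mulgV defect1. Qed.

Lemma tameM x y : tame x -> tame y -> tame (x * y)%g.
Proof.
move=> tx ty u.
have -> : (u * (x * y) * u^-1 = (u * x * u^-1) * (u * y * u^-1))%g.
  by rewrite !mulgA mulgVK.
by rewrite defect_eqM.
Qed.

Lemma tameV x : tame x -> tame x^-1%g.
Proof.
move=> tx u; apply/eqP; rewrite eq_le defect_ge0// andbT.
have := defectV mu_ge0 mu_total (u * x * u^-1)%g.
by rewrite tx !invgM invgK mulgA.
Qed.

Lemma tameJ x u : tame x -> tame (u * x * u^-1)%g.
Proof. by move=> tx v; have := tx (v * u)%g; rewrite invgM !mulgA. Qed.

Lemma seq_argmax (T : eqType) (f : T -> R) (l : seq T) x0 : x0 \in l ->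
  exists2 x, x \in l & forall y, y \in l -> f y <= f x.
Proof.
elim: l x0 => // a l IH x0 _.
case: l IH => [|b l] IH.
  by exists a; rewrite ?mem_head// => y; rewrite inE => /eqP ->.
have [x xl xmax] := IH b (mem_head _ _).
have [ax|xa] := leP (f a) (f x).
  exists x; first by rewrite inE xl orbT.
  by move=> y; rewrite inE => /orP[/eqP ->|/xmax].
exists a; rewrite ?mem_head// => y; rewrite inE => /orP[/eqP ->//|/xmax yx].
exact: le_trans yx (ltW xa).
Qed.

(** The supremum [psi m] of the defect over the conjugates of [h] by elements of
    degree m is bounded and subharmonic, hence constant.  In degree 0 it is
    attained, since the defect does not change modulo tame elements; the
    maximum over the whole class is then attained too, and it is 0. *)
Lemma tame_of_finite_fiber h (l : seq G) :
  (forall g, deg g = 0 -> exists2 z, z \in l & tame (g * h * g^-1 * z^-1)%g) ->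
  tame h.
Proof.
move=> fib; pose conj g := (g * h * g^-1)%g.
have conjM g g' : conj (g * g')%g = (g * conj g' * g^-1)%g.
  by rewrite /conj invgM !mulgA.
pose V m := [set defect (conj g) | g in [set g | deg g = m]].
pose psi m := sup (V m).
have V_le g : defect (conj g) <= psi (deg g).
  apply: ub_le_sup; last by exists g.
  by exists 2 => _ [x _ <-]; apply: defect_le2.
have psi_le m c : 0 <= c -> (forall g, deg g = m -> defect (conj g) <= c) ->
    psi m <= c.
  move=> c0 cub; rewrite /psi.
  have [->|/set0P Vm] := eqVneq (V m) set0; first by rewrite sup0.
  apply: ge_sup => //.
  by move=> _ [g /= gm <-]; apply: cub.
have psi_ge0 m : 0 <= psi m.
  rewrite /psi; have [->|/set0P[_ [g /= gm _]]] := eqVneq (V m) set0.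
    by rewrite sup0.
  rewrite -/(psi m).
  by rewrite -gm; apply: le_trans (V_le g); apply: defect_ge0.
have psi_bd m : 0 <= psi m <= 2.
  by rewrite psi_ge0 psi_le// => g _; apply: defect_le2.
have psi_sub m : psi m <= \sum_(s <- D) mu s * psi (m + deg s).
  apply: psi_le => [|g gm]; first by apply: sumr_ge0 => s _; rewrite mulr_ge0.
  apply: le_trans (defect_subharmonic mu_ge0 mu_total 1 (conj g)) _ => /=.
  apply: ler_sum => s _; apply: ler_wpM2l => //.
  by rewrite mulg1 -conjM (le_trans (V_le _))// degM gm addrC.
have psi_cst g : psi (deg g) = psi 0.
  elim/D_gen: g => [|s x sD <-]; first by rewrite hom_deg1.
  by rewrite degM addrC (bounded_subharmonic_const psi_bd psi_sub).
pose l' :=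
  [seq z <- l | `[< exists2 g, deg g = 0 & defect (conj g) = defect z >]].
have in_l' g : deg g = 0 -> exists2 z, z \in l' & defect (conj g) = defect z.
  move=> g0; have [z zl tz] := fib g g0.
  have gz : defect (conj g) = defect z.
    have := tz 1%g; rewrite mul1g invg1 mulg1.
    move=> /(@defect_eqM R G mu D mu_ge0 mu_total z) <-.
    by rewrite mulgVK.
  by exists z => //; rewrite mem_filter zl andbT; apply/asboolP; exists g.
have [z0 z0l' _] := in_l' 1%g hom_deg1.
have [z zl' zmax] := seq_argmax (fun z => defect z) z0l'.
move: (zl'); rewrite mem_filter => /andP[/asboolP[g0 _ g0z] _].
have psi0 : psi 0 <= defect (conj g0).
  apply: psi_le => [|g gz]; first exact: defect_ge0.
  by have [z' /zmax z'z ->] := in_l' g gz; rewrite g0z.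
have conj0 : defect (conj g0) = 0.
  apply: (defect_max0 mu_ge0 mu_total law_gt0) => x; rewrite -conjM.
  by apply: le_trans psi0; rewrite -(psi_cst (x * g0)%g); apply: V_le.
move=> u; apply/eqP; rewrite eq_le defect_ge0// andbT.
by rewrite -conj0 (le_trans (V_le u))// psi_cst.
Qed.

End Tameness.

(** * From the definitions to finite sums *)

Lemma esum_finite_support (R : realType) (T : choiceType) (f : T -> R)
    (l : seq T) (V : set T) :
  uniq l -> (forall x, 0 <= f x) -> (forall x, x \notin l -> f x = 0) ->
  \esum_(x in V) (f x)%:E = (\sum_(x <- l) f x * (x \in V)%:R)%:E.
Proof.
move=> ul f0 fl; pose F x := f x * (x \in V)%:R.
have F0 x : (0 <= (F x)%:E)%E by rewrite lee_fin mulr_ge0.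
have -> : \esum_(x in V) (f x)%:E = \esum_(x in [set: T]) (F x)%:E.
  rewrite esum_mkcond; apply: eq_esum => x _; rewrite /F.
  by case: ifP; rewrite ?mulr1 ?mulr0.
rewrite (esumID [set` l])// setTI setTI [X in (_ + X)%E]esum1; last first.
  by move=> x /= /negP xl; rewrite /F fl ?mul0r.
rewrite adde0 esum_fset; [|exact: finite_seq|by []].
by rewrite -fsbig_seq// sumEFin.
Qed.

Section Spelling.
Variables (G : groupType) (A : set G).

Lemma spells1 : spells A 1%g [::].
Proof. by split=> //; rewrite big_nil. Qed.

Lemma spells_letter a : A a -> spells A a [:: a].
Proof.
move=> Aa; split; last by rewrite big_seq1.
by move=> s; rewrite inE => /eqP ->; left.
Qed.

Lemma spellsM x y u v :
  spells A x u -> spells A y v -> spells A (x * y)%g (u ++ v).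
Proof.
move=> [uA <-] [vA <-]; split; last by rewrite big_cat.
by move=> s; rewrite mem_cat => /orP[/uA|/vA].
Qed.

Lemma spellsV x u :
  spells A x u -> spells A x^-1%g (rev [seq s^-1%g | s <- u]).
Proof.
move=> [uA <-]; split.
  move=> s; rewrite mem_rev => /mapP[z /uA zA ->].
  by rewrite invgK; case: zA; [right|left].
elim: u {uA} => [|s u IHu]; first by rewrite !big_nil invg1.
by rewrite /= rev_cons -cats1 big_cat IHu big_seq1 big_cons invgM.
Qed.

End Spelling.

Section Words.
Variables (G : groupType) (S : set G).
Hypothesis S_gen : generates S.

Lemma word_lengthP g :
  (exists2 w, spells S g w & size w = word_length S g) /\
  (forall w, spells S g w -> (word_length S g <= size w)%N).
Proof.
pose P := [set n | (exists w, spells S g w /\ size w = n) /\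
                    (forall w, spells S g w -> (n <= size w)%N)].
have [n Pn] : exists n, P n.
  have ex : exists n, `[< exists w, spells S g w /\ size w = n >].
    by have [w gw] := S_gen g; exists (size w); apply/asboolP; exists w.
  case: (ex_minnP ex) => n /asboolP nw nmin; exists n; split=> // w gw.
  by apply: nmin; apply/asboolP; exists w.
have : P (word_length S g) by apply: xgetI Pn.
by move=> [[w [gw sw]] lmin]; split=> //; exists w.
Qed.

Lemma word_length1 : word_length S 1%g = 0%N.
Proof.
by have [_ /(_ _ (spells1 S))] := word_lengthP 1%g; rewrite leqn0 => /eqP.
Qed.

Lemma word_lengthM x y :
  (word_length S (x * y)%g <= word_length S x + word_length S y)%N.
Proof.
have [[u Su <-] _] := word_lengthP x; have [[v Sv <-] _] := word_lengthP y.
have [_ min_xy] := word_lengthP (x * y)%g.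
by rewrite -size_cat; apply: min_xy; apply: spellsM.
Qed.

Lemma word_lengthX x n : (word_length S (x ^+ n)%g <= n * word_length S x)%N.
Proof.
elim: n => [|n IHn]; first by rewrite expg0 word_length1.
by rewrite expgS mulSn (leq_trans (word_lengthM _ _))// leq_add2l.
Qed.

Lemma word_ball_finite : finite_set S ->
  forall M, exists l : seq G, forall g, (word_length S g <= M)%N -> g \in l.
Proof.
move=> /finite_seqP[s sE] M; pose letters := s ++ [seq x^-1%g | x <- s].
pose extend b := b ++ allpairs (fun a x => a * x)%g letters b.
pose ball := iter M extend [:: 1%g].
exists ball => g; have [[w [wS <-] <-] _] := word_lengthP g.
rewrite /ball; elim: M {ball g} w wS => [|M IHM] [|a w] wS //= wM.
- by rewrite big_nil inE.
- by rewrite mem_cat IHM.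
rewrite mem_cat big_cons; apply/orP; right.
apply: (allpairs_f (fun a x => a * x)%g); last first.
  by apply: IHM => // x xw; apply: wS; rewrite inE xw orbT.
rewrite mem_cat; have := wS a (mem_head _ _); rewrite sE /= => -[->//|aV].
by apply/orP; right; apply/mapP; exists a^-1%g; rewrite ?invgK.
Qed.

End Words.

Section Walk.
Variables (R : realType) (G : groupType) (mu : G -> R) (D : seq G).
Hypothesis mu_ge0 : forall s, 0 <= mu s.
Hypothesis D_uniq : uniq D.
Hypothesis D_supp : forall s, (s \in D) = (0 < mu s).

Lemma mu_notin s : s \notin D -> mu s = 0.
Proof. by rewrite D_supp lt0r mu_ge0 andbT negbK => /eqP. Qed.

Lemma convolution_powerE n : convolution_power mu n = law mu D n.
Proof.
apply/funext; elim: n => [|n IHn] g.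
  by rewrite /law /= /point_mass eq_sym.
rewrite lawS -[LHS]/(convolution mu (convolution_power mu n) g) /convolution.
have -> : convolution_power mu n = law mu D n by apply/funext.
rewrite (@esum_finite_support _ _ _ D)//=.
- by apply: eq_bigr => s _; rewrite in_setT mulr1.
- by move=> s; rewrite mulr_ge0// law_ge0.
- by move=> s /mu_notin ->; rewrite mul0r.
Qed.

Lemma measure_ofE n V : measure_of (convolution_power mu n) V =
  (expect mu D n (fun x => (x \in V)%:R))%:E.
Proof.
rewrite convolution_powerE /measure_of (@esum_finite_support _ _ _ (reach D n)).
- by rewrite [in RHS]expectE.
- exact: reach_uniq.
- by move=> x; apply: law_ge0.
- by move=> x; apply: law_notin.
Qed.

Lemma law1 s : law mu D 1 s = mu s.
Proof.
rewrite /law /=; under eq_bigr do rewrite mulg1 eq_sym.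
rewrite delta_sum//; case: (boolP (s \in D)) => [_|/mu_notin ->].
  by rewrite mul1r.
by rewrite mul0r.
Qed.

Lemma law_mul m n x y :
  law mu D m x * law mu D n y <= law mu D (m + n) (x * y)%g.
Proof.
rewrite [leRHS]/law expect_add.
apply: le_trans; last first.
  apply: (@law_le R G mu D mu_ge0 m x) => z.
  rewrite -(mul0r (expect mu D n (fun=> 0))).
  by rewrite -expectZ; apply: expect_le => // v; rewrite mul0r.
rewrite ler_wpM2l ?law_ge0//; apply: expect_le => // v.
by case: (v =P y) => [->|]; rewrite ?eqxx.
Qed.

Lemma law_gt0M m n x y : 0 < law mu D m x -> 0 < law mu D n y ->
  0 < law mu D (m + n) (x * y)%g.
Proof.
by move=> mx ny; apply: lt_le_trans (law_mul _ _ _ _); apply: mulr_gt0.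
Qed.

End Walk.

(** By symmetry mu^2(1) > 0, hence mu^k(1) > 0 for even k.  Aperiodicity forces
    an odd k0 with mu^k0(1) > 0, and then all k >= k0 qualify.  An element
    reached at time n is thus charged at all times from n + k0 on. *)
Lemma simple_random_walkP (R : realType) (G : groupType) (mu : G -> R) :
  simple_random_walk mu -> exists D, walk_on mu D.
Proof.
move=> [[mu_ge0 mu1] mu_sym /finite_seqP[l lE] mu_gen mu_aper].
pose D := undup l.
have D_supp s : (s \in D) = (0 < mu s).
  rewrite mem_undup; apply/idP/idP => h.
    by have : [set` l] s by []; rewrite -lE.
  by have : support_of mu s by []; rewrite lE.
have D_uniq : uniq D := undup_uniq l.
have notD := mu_notin mu_ge0 D_supp.
have total : \sum_(s <- D) mu s = 1.
  apply: EFin_inj; rewrite -mu1 /measure_of (@esum_finite_support _ _ _ D)//.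
  by congr EFin; apply: eq_bigr => s _; rewrite in_setT mulr1.
have D_gen (P : G -> Prop) : P 1%g ->
    (forall s x, s \in D -> P x -> P (s * x)%g) -> forall g, P g.
  move=> P1 PM g; have [w [wD <-]] := mu_gen g.
  elim: w wD => [|s w IHw] wD; first by rewrite big_nil.
  rewrite big_cons; apply: PM.
    by rewrite D_supp; case: (wD s (mem_head _ _));
      rewrite /support_of/= ?mu_sym.
  by apply: IHw => x xw; apply: wD; rewrite inE xw orbT.
pose P n g := 0 < law mu D n g.
have PM m n x y : P m x -> P n y -> P (m + n)%N (x * y)%g.
  exact: law_gt0M.
have PD s : s \in D -> P 1%N s by rewrite /P law1// D_supp.
have Pex g : exists n, P n g.
  elim/D_gen: g => [|s x sD [n Pn]].
    by exists 0%N; rewrite /P /law /= eqxx ltr01.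
  by exists (1 + n)%N; apply: (PM) => //; apply: PD.
have [s sD] : exists s, s \in D.
  case: (D) total => [|s D' _]; last by exists s; rewrite mem_head.
  by rewrite big_nil => /eqP; rewrite eq_sym oner_eq0.
have P_even j : P (j.*2)%N 1%g.
  elim: j => [|j IHj]; first by rewrite /P /law /= eqxx ltr01.
  rewrite doubleS -addn2 -[1%g]mulg1; apply: (PM) => //.
  rewrite -(mulgV s); apply: (PM 1%N 1%N); apply: (PD) => //.
  by rewrite D_supp mu_sym -D_supp.
(* If all return times were even, 2 would divide their gcd. *)
have [k0 [Pk0 odd_k0]] : exists k, P k 1%g /\ odd k.
  apply: contrapT => no_odd; case: mu_aper => _ /(_ 2%N) h.
  suff : (2 %| 1)%N by [].
  apply: h => k [_]; rewrite (convolution_powerE mu_ge0 D_uniq D_supp) => Pk.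
  by rewrite dvdn2; apply/negP => ok; apply: no_odd; exists k.
have P_large K : (k0 <= K)%N -> P K 1%g.
  move=> kK; case: (boolP (odd K)) => oK; last first.
    by rewrite -(even_halfK oK).
  rewrite -(subnKC kK) -[1%g]mulg1; apply: (PM) => //.
  have oKk : ~~ odd (K - k0) by rewrite oddB// oK odd_k0.
  by rewrite -(even_halfK oKk).
exists D; split=> // [|y].
  apply: uniq_perm => //; first by rewrite map_inj_uniq//; apply: invg_inj.
  move=> x; rewrite -[x in LHS]invgK mem_map; last exact: invg_inj.
  by rewrite !D_supp mu_sym.
have [n Pn] := Pex y.
near=> K; rewrite -/(P K y) -[y]mulg1 -(@subnKC n K); last by near: K; exists n.
apply: (PM) => //; apply: P_large; rewrite leq_subRL; last by near: K; exists n.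
by near: K; exists (n + k0)%N.
Unshelve. all: by end_near. Qed.

(** * Almost invariance *)

Section AlmostInvariance.
Variables (R : realType) (G : groupType) (mu : G -> R) (D : seq G).
Hypothesis mu_walk : walk_on mu D.
Let mu_ge0 := walk_ge0 mu_walk.
Let mu_total := walk_total mu_walk.
Let D_uniq := walk_uniq mu_walk.
Let D_supp := walk_supp mu_walk.

(** Tests the distance on the sign of law (h g) - law h, restricted to [c]. *)
Lemma law_variation_le_osc n g (c : pred G) :
  \sum_(h <- reach D n | c h) `|law mu D n (h * g)%g - law mu D n h|
  <= osc mu D n g^-1%g.
Proof.
pose F h : R := (c h)%:R * Num.sg (law mu D n (h * g)%g - law mu D n h).
pose f x := \sum_(h <- reach D n) F h * (x == h)%:R.
have f1 x : `|f x| <= 1.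
  rewrite /f delta_sum ?reach_uniq// !normrM !normr_nat.
  rewrite -[leRHS]mul1r ler_pM ?mulr_ge0//; first by case: (x \in _).
  rewrite -[leRHS]mul1r ler_pM//; first by case: (c x).
  by rewrite normr_sg; case: (_ != _).
apply: le_trans (bias_le_osc mu_ge0 mu_total n g^-1%g f1).
rewrite /bias /f !expect_sum -sumrB big_mkcond /= ler_sum// => h _.
rewrite !expectZ -mulrBr /F.
have -> : expect mu D n (fun x => (x * g^-1 == h)%g%:R) = law mu D n (h * g)%g.
  congr expect; apply/funext => x; congr ((_ : bool)%:R).
  by apply/eqP/eqP => [<-|->]; rewrite ?mulgVK ?mulgK.
by case: (c h); rewrite ?mul0r// mul1r -normrEsg.
Qed.

(** Markov inequality: the points where some ratio is off by more than [eps]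
    have mass at most eps^-1 times the sum over [l] of the l^1 distances, and
    this sum is eventually below eps^2. *)
Lemma almost_invariant_on_finite (l : seq G) (eps : R) :
  (forall y, defect mu D y = 0) -> 0 < eps ->
  \forall n \near \oo, exists V : set G,
    ((1 - eps)%:E <= measure_of (convolution_power mu n) V)%E /\
    forall h g : G, V h -> g \in l ->
      0 < convolution_power mu n h /\
      `|convolution_power mu n (h * g)%g / convolution_power mu n h - 1| <= eps.
Proof.
move=> def0 eps0.
have cv : \sum_(g <- l) osc mu D n g^-1%g @[n --> \oo]
    --> \sum_(g <- l) defect mu D g^-1%g.
  apply: cvg_big => [|g _]; first exact: add_continuous.
  exact: (defect_cvg mu_ge0 mu_total).
have ee : \sum_(g <- l) defect mu D g^-1%g < eps * eps.
  by rewrite big1 ?mulr_gt0.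
apply: filterS (cvgr_lt _ cv _ ee) => n osc_small.
pose p := law mu D n.
pose bad g h := (0 < p h) && (eps < `|p (h * g)%g / p h - 1|).
exists [set h | 0 < p h /\ forall g, g \in l -> ~~ bad g h].
rewrite (measure_ofE mu_ge0 D_uniq D_supp).
rewrite (convolution_powerE mu_ge0 D_uniq D_supp).
split=> [|h g [ph good] gl]; last first.
  by split=> //; have := good g gl; rewrite /bad ph/= -leNgt.
set V := [set _ | _].
have mass_bad g :
    eps * \sum_(h <- reach D n | bad g h) p h <= osc mu D n g^-1%g.
  apply: le_trans (law_variation_le_osc n g (bad g)).
  rewrite mulr_sumr; apply: ler_sum => h /andP[ph /ltW far].
  rewrite -(ler_pM2r ph) in far; apply: le_trans far _.
  by rewrite -{2}(gtr0_norm ph) -normrM mulrBl mul1r divfK ?gt_eqF.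
rewrite lee_fin lerBlDr -lerBlDl.
rewrite -[X in X - expect _ _ _ _](expect_cst mu_total n) -expectB expectE.
rewrite -(ler_pM2l eps0); apply: le_trans (ltW osc_small).
apply: (@le_trans _ _
  (eps * \sum_(g <- l) \sum_(h <- reach D n | bad g h) p h)).
  rewrite ler_pM2l//; under [leRHS]eq_bigr do rewrite big_mkcond.
  rewrite exchange_big /=; apply: ler_sum => h _; rewrite -/p.
  have p0 : 0 <= p h by apply: law_ge0.
  have sum0 (l' : seq G) : 0 <= \sum_(g <- l') (if bad g h then p h else 0).
    by apply: sumr_ge0 => g _; case: ifP.
  case: (boolP (h \in V)) => [_|]; first by rewrite subrr mulr0.
  rewrite subr0 mulr1 notin_setE /V /= => hV.
  move: p0; rewrite le_eqVlt => /predU1P[p0|ph]; first by rewrite -{1}p0.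
  have [g gl bg] : exists2 g, g \in l & bad g h.
    apply: contrapT => nb; apply: hV; split=> // g gl.
    by apply/negP => bg; apply: nb; exists g.
  elim: (l) gl sum0 => // a l' IHl.
  rewrite inE big_cons => /predU1P[<-|gl] sum0.
    by rewrite bg lerDl.
  apply: le_trans (IHl gl sum0) _.
  by rewrite lerDr; case: ifP => // _; apply: ltW.
by rewrite mulr_sumr; apply: ler_sum.
Qed.

(** [r n] is the largest M <= n whose threshold has been passed at time n. *)
Lemma diagonal_radius (good : nat -> nat -> Prop) :
  (forall M, \forall n \near \oo, good M n) ->
  exists r : nat -> nat, (forall M, \forall n \near \oo, (M <= r n)%N) /\
    \forall n \near \oo, good (r n) n.
Proof.
move=> goodM.
have /choice[N N_good] : forall M, exists N, forall n, (N <= n)%N -> good M n.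
  by move=> M; have [N _ NM] := goodM M; exists N => n; apply: NM.
pose r n := (\max_(M < n.+1 | N M <= n) M)%N; exists r; split=> [M|].
  exists (maxn M (N M)) => // n /=; rewrite geq_max => /andP[Mn NMn].
  have MSn : (M < n.+1)%N by [].
  exact: (@leq_bigmax_cond _ (fun M : 'I_n.+1 => (N M <= n)%N) _ (Ordinal MSn)).
exists (N 0%N) => // n /= N0n.
have [|M MN rM] :=
    @eq_bigmax_cond _ (fun M : 'I_n.+1 => (N M <= n)%N) (fun M => M : nat).
  by apply/card_gt0P; exists ord0.
have -> : r n = M by exact: rM.
exact: N_good.
Qed.

Lemma radius_ai_not_bounded_of_defect (S : set G) :
  finite_set S -> generates S -> (forall y, defect mu D y = 0) ->
  radius_ai_not_bounded S mu.
Proof.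
move=> S_fin S_gen def0.
pose good M n := exists V : set G,
  ((1 - M.+1%:R^-1 : R)%:E <= measure_of (convolution_power mu n) V)%E /\
  forall h g : G, V h -> (word_length S g <= M)%N ->
    0 < convolution_power mu n h /\
    `|convolution_power mu n (h * g)%g / convolution_power mu n h - 1|
      <= M.+1%:R^-1.
have [|r [r_oo r_good]] := @diagonal_radius good.
  move=> M; have [l lM] := word_ball_finite S_gen S_fin M.
  have Mpos : 0 < M.+1%:R^-1 :> R by rewrite invr_gt0.
  apply: filterS (almost_invariant_on_finite l def0 Mpos) => n [V [V1 V2]].
  by exists V; split=> // h g Vh /lM; apply: V2.
exists (fun n => (r n)%:R); split=> [//|M|eps eps0].
  have [N _ /(_ N (leqnn N)) NM] := r_oo (Num.truncn M).+1.
  by exists N; apply: lt_le_trans (truncnS_gt M) _; rewrite ler_nat.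
apply: filterS2 (r_oo (Num.truncn eps^-1)) r_good => n rn [V [V1 V2]].
have small : (r n).+1%:R^-1 <= eps.
  rewrite -[leRHS]invrK lef_pV2 ?posrE ?invr_gt0//.
  by apply: le_trans (ltW (truncnS_gt _)) _; rewrite ler_nat.
exists V; split=> [|h g Vh]; first by apply: le_trans V1; rewrite lee_fin lerB.
rewrite ler_nat => gr; have [ph close] := V2 h g Vh gr; split=> //.
exact: le_trans close small.
Qed.

(** The elements [a x] send the complement of the event [u x] into it, so
    invariance gives each of three disjoint events a mass of nearly 1/2. *)
Lemma no_invariant_mass (n : nat) (a : 'I_3 -> G) (u : 'I_3 -> pred G)
    (V : set G) (eps : R) :
  eps < 6^-1 -> 0 <= eps ->
  (forall h, \sum_(x < 3) (u x h)%:R <= 1 :> R) ->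
  (forall x h, h \in reach D n -> ~~ u x h -> u x (h * a x)%g) ->
  (1 - eps <= expect mu D n (fun h => (h \in V)%:R)) ->
  (forall x h, V h -> (1 - eps) * law mu D n h <= law mu D n (h * a x)%g) ->
  False.
Proof.
move=> eps6 eps0 u_disj u_move V_mass V_inv.
pose m x := expect mu D n (fun h => (u x h)%:R).
have m_sum : \sum_(x < 3) m x <= 1.
  rewrite /m -expect_sum -[leRHS](expect_cst mu_total n).
  exact: expect_le.
suff m_big x : (1 - 2 * eps) / 2 <= m x.
  have : \sum_(x < 3) ((1 - 2 * eps) / 2) <= 1.
    by apply: le_trans m_sum; apply: ler_sum.
  by rewrite sumr_const card_ord -mulr_natl; lra.
pose W h : R := (h \in V)%:R * (~~ u x h)%:R.
have W_mass : 1 - eps - m x <= expect mu D n W.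
  apply: le_trans (lerB V_mass (lexx (m x))) _; rewrite /m -expectB.
  apply: expect_le => // h; rewrite /W.
  by case: (_ \in _); case: (u x h); rewrite /= ?mulr1 ?mulr0; lra.
have : (1 - eps) * expect mu D n W <= m x.
  rewrite expectE mulr_sumr.
  pose f y : R :=
    \sum_(k <- [seq h * a x | h <- reach D n]%g) (u x k)%:R * (y == k)%:R.
  apply: (@le_trans _ _ (expect mu D n f)).
    rewrite /f expect_sum big_map big_seq [leRHS]big_seq.
    apply: ler_sum => h hn; rewrite expectZ -/(law _ _ _ _) /W.
    case: (boolP (h \in V)) => [|_]; last first.
      by rewrite mul0r !mulr0 mulr_ge0// law_ge0.
    rewrite inE mul1r => Vh; case: (boolP (u x h)) => ux /=.
      by rewrite !mulr0 mulr_ge0// law_ge0.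
    by rewrite u_move// mul1r mulr1; apply: V_inv.
  apply: expect_le => // y; rewrite /f delta_sum; last first.
    by rewrite map_inj_uniq ?reach_uniq//; apply: mulIg.
  by case: (_ \in _); rewrite ?mul1r// mul0r.
have : (1 - eps) * (1 - eps - m x) <= (1 - eps) * expect mu D n W.
  by apply: ler_wpM2l => //; lra.
have m0 : 0 <= m x.
  by rewrite -(expect_cst mu_total n 0); apply: expect_le.
have := mulr_ge0 eps0 m0; have := sqr_ge0 eps; rewrite expr2.
by move=> ? ? ? ?; nra.
Qed.

End AlmostInvariance.

(** * Three involutions on words *)

Section Toggle.
Variable M : nat.

Definition starts (x : 'I_3) (w : seq 'I_3) := ohead w == Some x.

(** Left fixed are the words of full length that do not start with x, for which
    there is no room, and the words that start with x x; the latter makes the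
    map an involution on all words, reduced or not. *)
Definition toggle_seq (x : 'I_3) (w : seq 'I_3) :=
  if starts x w then if starts x (behead w) then w else behead w
  else if (size w < M)%N then x :: w else w.

Lemma toggle_size (x : 'I_3) (w : M.-bseq 'I_3) :
  (size (toggle_seq x w) <= M)%N.
Proof.
have := size_bseq w; rewrite /toggle_seq; case: ifP => _.
  by case: ifP => _ //; rewrite size_behead; lia.
by case: ifP.
Qed.

Definition toggle (x : 'I_3) (w : M.-bseq 'I_3) : M.-bseq 'I_3 :=
  Bseq (toggle_size x w).

Lemma starts_cons x y w : starts x (y :: w) = (y == x).
Proof. by []. Qed.

Lemma toggleK x : involutive (toggle x).
Proof.
move=> w; apply/val_inj => /=; rewrite /toggle_seq.
have := size_bseq w; case: (val w) => [|y s] /= sw.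
  by case: (ltnP 0 M) => M0; rewrite ?starts_cons ?eqxx //= ltnNge M0.
rewrite !starts_cons; have [->|yx] := eqVneq y x; last first.
  by case: (ltnP (size s).+1 M) => sM;
    rewrite starts_cons ?eqxx /= ?starts_cons ?(negPf yx) // ltnNge sM.
case: (boolP (starts x s)) => [ss|/negPf ss].
  by rewrite starts_cons eqxx /= ss.
by rewrite ss sw.
Qed.

Definition flip x : {perm (M.-bseq 'I_3)} := perm (inv_inj (toggleK x)).

Lemma flip_starts x (w : M.-bseq 'I_3) :
  ~~ starts x w -> (size w < M)%N -> starts x (flip x w).
Proof.
by move=> nw sw; rewrite permE /= /toggle_seq (negPf nw) sw /starts /=.
Qed.

Lemma size_flip x (w : M.-bseq 'I_3) : (size (flip x w) <= (size w).+1)%N.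
Proof.
rewrite permE /= /toggle_seq; case: ifP => _; case: ifP => // _.
by rewrite size_behead; lia.
Qed.

Lemma flip2 x : (flip x * flip x = 1)%g.
Proof. by apply/permP => w; rewrite permM !permE /= toggleK. Qed.

End Toggle.

(** * The group *)

Section Wreath.
Variable N : nat -> nat.

Definition lamps := forall k : nat, int -> {perm ((N k).-bseq 'I_3)}.

Definition wreath : Type := (lamps * int)%type.

(** The second factor shifts the lamps of the first, so that right
    multiplication by an element of degree 0 acts sitewise. *)
Definition wreath_mul (u v : wreath) : wreath :=
  ((fun k i => u.1 k (i + v.2) * v.1 k i)%g, u.2 + v.2).

Definition wreath_one : wreath := ((fun k i => 1%g), 0).

Definition wreath_inv (u : wreath) : wreath :=
  ((fun k i => (u.1 k (i - u.2))^-1)%g, - u.2).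

Lemma wreath_ext (u v : wreath) :
  (forall k i, u.1 k i = v.1 k i) -> u.2 = v.2 -> u = v.
Proof.
case: u v => [f m] [f' m'] /= ff' ->; congr pair.
by apply/functional_extensionality_dep => k; apply/funext => i; apply: ff'.
Qed.

HB.instance Definition _ := gen_eqMixin wreath.
HB.instance Definition _ := gen_choiceMixin wreath.

Lemma wreath_mulA : associative wreath_mul.
Proof.
move=> u v w; apply: wreath_ext => [k i|] /=; last by rewrite addrA.
by rewrite mulgA; congr (u.1 k _ * _ * _)%g; lia.
Qed.

Lemma wreath_mul1 : left_id wreath_one wreath_mul.
Proof. by move=> u; apply: wreath_ext => [k i|] /=; rewrite ?mul1g ?add0r. Qed.

Lemma wreath_mulr1 : right_id wreath_one wreath_mul.
Proof. by move=> u; apply: wreath_ext => [k i|] /=; rewrite ?mulg1 !addr0. Qed.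

Lemma wreath_mulV : left_inverse wreath_one wreath_inv wreath_mul.
Proof.
move=> u; apply: wreath_ext => [k i|] /=; last by rewrite addNr.
by rewrite addrK mulVg.
Qed.

Lemma wreath_mulrV : right_inverse wreath_one wreath_inv wreath_mul.
Proof.
move=> u; apply: wreath_ext => [k i|] /=; last by rewrite addrN.
by rewrite mulgV.
Qed.

HB.instance Definition _ := isGroup.Build wreath
  wreath_mulA wreath_mul1 wreath_mulr1 wreath_mulV wreath_mulrV.

End Wreath.

Section Span.
Variables (W : groupType) (A : set W).

Definition spelled : pred W := fun g => `[< exists w, spells A g w >].

Lemma spelled_closed : group_closed spelled.
Proof.
split=> [|x y /asboolP[u Au] /asboolP[v Av]]; apply/asboolP.
  by exists [::]; apply: spells1.
exists (u ++ rev [seq s^-1%g | s <- v]).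
by apply: spellsM => //; apply: spellsV.
Qed.

Definition gen_subgroup := {g : W | spelled g}.
HB.instance Definition _ := Choice.on gen_subgroup.
HB.instance Definition _ := SubType.on gen_subgroup.

HB.instance Definition _ :=
  SubChoice_isSubGroup.Build W spelled gen_subgroup spelled_closed.

Lemma spelled_mem a : A a -> spelled a.
Proof. by move=> Aa; apply/asboolP; exists [:: a]; apply: spells_letter. Qed.

Definition generator a (Aa : A a) : gen_subgroup := Sub a (spelled_mem Aa).

Definition generators : set gen_subgroup := [set g | A (val g)].

Lemma gen_subgroup_ind (P : gen_subgroup -> Prop) :
  P 1%g -> (forall x y, P x -> P y -> P (x * y)%g) ->
  (forall x, P x -> P x^-1%g) -> (forall s, A (val s) -> P s) -> forall g, P g.
Proof.
move=> P1 PM PV PA [g sg]; have /asboolP[w [wA wg]] := sg.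
suff [h hw Ph] : exists2 h : gen_subgroup, val h = (\prod_(s <- w) s)%g & P h.
  by have -> : exist _ g sg = h by apply: val_inj; rewrite hw wg.
elim: w {g sg wg} wA => [|s w IHw] wA.
  by exists 1%g => //; rewrite big_nil; apply: val1.
have [|h hw Ph] := IHw; first by move=> x xw; apply: wA; rewrite inE xw orbT.
have [s' ss' Ps'] : exists2 s' : gen_subgroup, val s' = s & P s'.
  case: (wA s (mem_head _ _)) => As.
    by exists (generator As) => //; apply: PA.
  exists (generator As)^-1%g; last by apply/PV/PA.
  by rewrite gmulfV /= invgK.
exists (s' * h)%g; last exact: PM.
by rewrite valM big_cons ss' hw.
Qed.

Lemma generators_generate : generates generators.
Proof.
elim/gen_subgroup_ind => [|x y [u Au] [v Av]|x [u Au]|s As].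
- by exists [::]; apply: spells1.
- by exists (u ++ v); apply: spellsM.
- by exists (rev [seq s^-1%g | s <- u]); apply: spellsV.
- by exists [:: s]; apply: spells_letter.
Qed.

Lemma finite_generators : finite_set A -> finite_set generators.
Proof. by apply: finite_preimage => x y _ _; apply: val_inj. Qed.

End Span.

Section Tower.
Variable N : nat -> nat.
Local Notation W := (wreath N).

Definition place (x : 'I_3) (k : nat) : int := (x * k)%N%:Z.

Definition shift : W := ((fun _ _ => 1%g), 1).
Definition switch (x : 'I_3) : W :=
  ((fun k i => if i == place x k then flip (N k) x else 1%g), 0).

Definition basis : set W := shift |` range switch.

Definition tower : groupType := gen_subgroup basis.

Lemma basis_shift : basis shift. Proof. by left. Qed.
Lemma basis_switch x : basis (switch x). Proof. by right; exists x. Qed.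

Definition tshift : tower := generator basis_shift.
Definition tswitch x : tower := generator (basis_switch x).

Lemma tower_ind (P : tower -> Prop) :
  P 1%g -> (forall x y, P x -> P y -> P (x * y)%g) ->
  (forall x, P x -> P x^-1%g) -> P tshift -> (forall x, P (tswitch x)) ->
  forall g, P g.
Proof.
move=> P1 PM PV Pt Ps; apply: gen_subgroup_ind => // s [sE|[x _ sE]].
  by have -> : s = tshift by apply: val_inj; rewrite sE.
by have -> : s = tswitch x by apply: val_inj; rewrite -sE.
Qed.

Lemma tower_fg : finitely_generated tower.
Proof.
exists (@generators _ basis); split; last exact: generators_generate.
apply: finite_generators; rewrite finite_setU; split=> //.
exact: finite_image.
Qed.

Definition deg (g : tower) : int := (val g).2.
Definition lamp (g : tower) k i : {perm ((N k).-bseq 'I_3)} := (val g).1 k i.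

Lemma degM g h : deg (g * h)%g = deg g + deg h.
Proof. by rewrite /deg valM. Qed.

Lemma degV g : deg g^-1%g = - deg g.
Proof. by rewrite /deg gmulfV. Qed.

Lemma lamp1 k i : lamp 1%g k i = 1%g.
Proof. by rewrite /lamp val1. Qed.

Lemma lampM g h k i :
  lamp (g * h)%g k i = (lamp g k (i + deg h) * lamp h k i)%g.
Proof. by rewrite /lamp valM. Qed.

Lemma lampV g k i : lamp g^-1%g k i = (lamp g k (i - deg g))^-1%g.
Proof. by rewrite /lamp gmulfV. Qed.

Lemma lamp_shift k i : lamp tshift k i = 1%g. Proof. by []. Qed.

Lemma deg_shift : deg tshift = 1. Proof. by []. Qed.

Lemma lamp_switch x k i :
  lamp (tswitch x) k i = if i == place x k then flip (N k) x else 1%g.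
Proof. by []. Qed.

Lemma deg_switch x : deg (tswitch x) = 0. Proof. by []. Qed.

Lemma deg_shiftX n : deg (tshift ^+ n)%g = n%:Z.
Proof.
elim: n => [|n IHn]; first by rewrite expg0 /deg val1.
by rewrite expgS degM IHn deg_shift; lia.
Qed.

Lemma lamp_shiftX n k i : lamp (tshift ^+ n)%g k i = 1%g.
Proof.
elim: n i => [|n IHn] i; first by rewrite expg0 lamp1.
by rewrite expgS lampM lamp_shift mul1g IHn.
Qed.

(** A fixed element sees only a bounded window of Z.  For large k the windows
    around the three places in the coordinate k are disjoint, and the lamps in
    the window around [place x k] are powers of [flip x].  Only the commutation
    is kept, because it passes to products and inverses. *)
Lemma lamp_commutes_at_places g (r : nat) :
  exists K, forall k, (K <= k)%N -> forall i : int, (`|i|%N <= r)%N ->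
  forall x, commute (lamp g k (i + place x k)) (flip (N k) x).
Proof.
elim/tower_ind: g r => [r|g h IHg IHh r|g IHg r|r|y r].
- exists 0%N => k _ i _ x; rewrite lamp1.
  by apply: commute_sym; apply: commute1.
- have [Kg cg] := IHg (r + `|deg h|)%N; have [Kh ch] := IHh r.
  exists (maxn Kg Kh) => k; rewrite geq_max => /andP[kg kh] i ir x.
  rewrite lampM; apply: commute_sym; apply: commuteM; apply: commute_sym.
    by rewrite addrAC; apply: cg => //; lia.
  exact: ch.
- have [K cK] := IHg (r + `|deg g|)%N; exists K => k Kk i ir x.
  rewrite lampV; apply: commute_sym; apply: commuteV; apply: commute_sym.
  by rewrite addrAC; apply: cK => //; lia.
- exists 0%N => k _ i _ x; rewrite lamp_shift.
  by apply: commute_sym; apply: commute1.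
exists r.+1 => k rk i ir x; rewrite lamp_switch.
case: ifP => [/eqP|_]; last by apply: commute_sym; apply: commute1.
have [->|yx] := eqVneq x y; first by [].
rewrite /place => e; exfalso.
have : (x : nat) <> y by move=> /val_inj/eqP; rewrite (negPf yx).
by move: (ltn_ord x) (ltn_ord y) => hx hy; nia.
Qed.

(** The second inequality is what passes the first one to inverses. *)
Lemma lamp_size_bound g : exists rho, forall k i w,
  (size (lamp g k i w) <= size w + rho)%N /\
  (size w <= size (lamp g k i w) + rho)%N.
Proof.
elim/tower_ind: g => [|g h [a ga] [b hb]|g [a ga]||x].
- by exists 0%N => k i w; rewrite lamp1 perm1; lia.
- exists (a + b)%N => k i w; rewrite lampM permM.
  by have := ga k (i + deg h) w; have := hb k i (lamp g k (i + deg h) w); lia.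
- exists a => k i w; rewrite lampV.
  have := ga k (i - deg g) ((lamp g k (i - deg g))^-1%g w).
  by rewrite permKV; lia.
- by exists 0%N => k i w; rewrite lamp_shift perm1; lia.
exists 1%N => k i w; rewrite lamp_switch.
case: ifP => _; last by rewrite perm1; lia.
have := size_flip x (flip (N k) x w); rewrite -permM flip2 perm1 !addn1.
by split => //; apply: size_flip.
Qed.

Lemma lamp_conj g h k i : deg g = 0 -> deg h = 0 ->
  lamp (g * h * g^-1)%g k i = (lamp g k i * lamp h k i * (lamp g k i)^-1)%g.
Proof. by move=> dg dh; rewrite !lampM lampV degV dg dh oppr0 subr0 !addr0. Qed.

(** Induction on the indices: an element is determined by its lamp at one index
    and by the result of resetting this lamp, so that no lamp needs to be
    carried from one coordinate type to another. *)
Lemma finite_lamp_elements (idx : seq (nat * int)) : exists l : seq tower,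
  forall g, deg g = 0 -> (forall k i, (k, i) \notin idx -> lamp g k i = 1%g) ->
  g \in l.
Proof.
pose B (idx : seq (nat * int)) := [set w : W | w.2 = 0 /\
  forall k i, (k, i) \notin idx -> w.1 k i = 1%g].
suff /finite_seqP[l lE] : finite_set (B idx).
  exists (pmap insub l) => g dg lg; rewrite mem_pmap_sub.
  by have : B idx (val g) by []; rewrite lE.
elim: idx => [|[k0 i0] idx IH].
  apply: (@sub_finite_set _ _ [set 1%g]); last exact: finite_set1.
  by move=> w [w2 w1]; apply: wreath_ext => // k i; rewrite w1.
pose reset (w : W) : W :=
  ((fun k i => if (k, i) == (k0, i0) then 1%g else w.1 k i), w.2).
pose f w := (reset w, w.1 k0 i0).
apply: (@sub_finite_set _ _ (f @^-1` (B idx `*` setT))).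
  move=> w [w2 w1]; split=> //=; split=> //= k i ki.
  by case: eqP => // /eqP kk; apply: w1; rewrite inE negb_or kk.
apply: finite_preimage; last by apply: finite_setX => //; apply: finite_finset.
move=> u v _ _ [euv e2 e0]; apply: wreath_ext => // k i.
have /(congr1 (fun f : lamps N => f k i)) := euv.
by case: eqP => // -[-> ->].
Qed.

Lemma lamp_size_reach (D : seq tower) : exists rho, forall n h,
  h \in reach D n -> forall k i w, (size (lamp h k i w) <= size w + n * rho)%N.
Proof.
have [rho rhoP] : exists rho, forall s, s \in D -> forall k i w,
    (size (lamp s k i w) <= size w + rho)%N.
  elim: (D) => [|s D' [b bP]]; first by exists 0%N.
  have [a aP] := lamp_size_bound s; exists (maxn a b) => z.
  rewrite inE => /predU1P[->|zD] k i w.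
    by have [] := aP k i w; lia.
  by have := bP z zD k i w; lia.
exists rho; elim=> [|n IHn] h.
  by rewrite inE => /eqP -> k i w; rewrite lamp1 perm1; lia.
rewrite mem_undup => /allpairsP[[s x] [/= sD xn ->]] k i w.
rewrite lampM permM.
apply: leq_trans (IHn x xn k i _) _.
by rewrite mulSn addnA leq_add2r rhoP.
Qed.

(** * Vanishing of the defect in the group *)

Section Tame.
Variables (R : realType) (mu : tower -> R) (D : seq tower).
Hypothesis mu_walk : walk_on mu D.
Local Notation tame := (tame mu D).

(** Conjugation in degree 0 keeps every lamp at its site, hence produces only
    finitely many elements. *)
Lemma tame_finite_lamps h (idx : seq (nat * int)) : deg h = 0 ->
  (forall k i, (k, i) \notin idx -> lamp h k i = 1%g) -> tame h.
Proof.
move=> dh lh; have [l lP] := finite_lamp_elements idx.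
apply: (tame_of_finite_fiber mu_walk degM (l := l)) => g dg.
exists (g * h * g^-1)%g; last by rewrite mulgV; apply: (tame1 mu_walk).
apply: lP => [|k i ki]; first by rewrite !degM degV dg dh.
by rewrite lamp_conj// lh// mulg1 mulgV.
Qed.

(** The commutator with an element g of degree 0 lives at the sites
    [place x k], and only for the finitely many k for which the lamp of g there
    does not commute with [flip x]; so it is tame. *)
Lemma tame_switch x : tame (tswitch x).
Proof.
apply: (tame_of_finite_fiber mu_walk degM (l := [:: tswitch x])) => g dg.
exists (tswitch x); first exact: mem_head.
have [K cK] := lamp_commutes_at_places g 0.
apply: (@tame_finite_lamps _ [seq (k, place x k) | k <- iota 0 K]).
  by rewrite !degM !degV dg deg_switch.
move=> k i ki; rewrite lampM lamp_conj// degV deg_switch oppr0 addr0.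
rewrite lampV deg_switch subr0 lamp_switch.
case: eqP => [ix|_]; last by rewrite mulg1 mulgV mul1g invg1.
have Kk : (K <= k)%N.
  rewrite leqNgt; apply: contra ki => kK.
  apply/mapP; exists k; last by rewrite ix.
  by rewrite mem_iota.
have := cK k Kk 0 (leqnn 0) x; rewrite add0r -ix => ->.
by rewrite mulgK mulgV.
Qed.

Lemma tame_commg_shift g : tame (g * tshift * g^-1 * tshift^-1)%g.
Proof.
elim/tower_ind: g => [|g h tg th|g tg||x].
- rewrite mul1g invg1 mulg1 mulgV; exact: (tame1 mu_walk).
- have -> : (g * h * tshift * (g * h)^-1 * tshift^-1 =
    g * (h * tshift * h^-1 * tshift^-1) * g^-1 *
    (g * tshift * g^-1 * tshift^-1))%g.
    by rewrite invgM !mulgA !mulgVK.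
  by apply: (tameM mu_walk) => //; apply: tameJ.
- have -> : (g^-1 * tshift * g^-1^-1 * tshift^-1 =
    g^-1 * (g * tshift * g^-1 * tshift^-1)^-1 * g^-1^-1)%g.
    by rewrite !invgM !invgK !mulgA mulgVK.
  by apply: tameJ; apply: (tameV mu_walk).
- rewrite mulgK mulgV; exact: (tame1 mu_walk).
rewrite -!mulgA; apply: (tameM mu_walk); first exact: tame_switch.
by rewrite mulgA; apply: tameJ; apply: (tameV mu_walk); apply: tame_switch.
Qed.

Lemma tame_tower g : tame g.
Proof.
elim/tower_ind: g => [|g h|g||x].
- exact: (tame1 mu_walk).
- exact: (tameM mu_walk).
- exact: (tameV mu_walk).
- apply: (tame_of_finite_fiber mu_walk degM (l := [:: tshift])) => g _.
  by exists tshift; [exact: mem_head|exact: tame_commg_shift].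
- exact: tame_switch.
Qed.

Lemma defect_tower g : defect mu D g = 0.
Proof. by have := tame_tower g 1%g; rewrite mul1g invg1 mulg1. Qed.

End Tame.

(** The conjugate that brings the [flip x] of the coordinate k to the site 0. *)
Definition probe (x : 'I_3) (k : nat) : tower :=
  (tshift ^- (x * k) * tswitch x * tshift ^+ (x * k))%g.

Lemma deg_probe x k : deg (probe x k) = 0.
Proof. by rewrite /probe !degM degV deg_shiftX deg_switch addr0 addNr. Qed.

Lemma lamp_probe x k : lamp (probe x k) k 0 = flip (N k) x.
Proof.
rewrite /probe !lampM lampV !lamp_shiftX mulg1 invg1 mul1g deg_shiftX add0r.
by rewrite lamp_switch eqxx.
Qed.

Lemma word_length_probe (S : set tower) : generates S -> exists C, forall x k,
  (word_length S (probe x k) <= C * k.+1)%N.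
Proof.
move=> S_gen; pose T := (word_length S tshift + word_length S tshift^-1%g)%N.
pose U := (\sum_x word_length S (tswitch x))%N.
exists (2 * T + U)%N => x k.
have Ux : (word_length S (tswitch x) <= U)%N.
  by rewrite /U (bigD1 x)//= leq_addr.
have hx : (x * k <= 2 * k)%N by rewrite leq_mul2r -ltnS ltn_ord orbT.
apply: leq_trans (word_lengthM S_gen _ _) _.
apply: leq_trans (leq_add (word_lengthM S_gen _ _) (leqnn _)) _.
have h1 := word_lengthX S_gen tshift (x * k).
have := word_lengthX S_gen tshift^-1%g (x * k); rewrite expVgn => h2.
have e : (x * k * word_length S tshift
    + x * k * word_length S tshift^-1%g <= 2 * k * T)%N.
  by rewrite -mulnDr leq_mul2r hx orbT.
apply: (@leq_trans (2 * k * T + U)); last first.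
  by rewrite mulnS; nia.
rewrite addnAC; apply: leq_add Ux; apply: leq_trans e.
by rewrite addnC leq_add.
Qed.

End Tower.

(** * The choice of the heights and the conclusion *)

Lemma height_function (R : realType) (F : nat -> R) :
  F n @[n --> \oo] --> +oo ->
  exists N : nat -> nat, forall k n, F n < k.+1%:R -> (k * n < N k)%N.
Proof.
move=> Foo.
have /choice[N NP] : forall k, exists m,
    forall n, F n < k.+1%:R -> (k * n < m)%N.
  move=> k; have /cvgryPge/(_ k.+1%:R)[n0 _ n0P] := Foo.
  exists (k * n0).+1 => n Fn; rewrite ltnS leq_mul2l leqNgt; apply/orP; right.
  by apply/negP => /ltnW/n0P /=; rewrite leNgt Fn.
by exists N.
Qed.

Theorem proposition1p8 (R : realType) (F : nat -> R)
    (F_gt0 : forall n, 0 < F n) (F_oo : F n @[n --> \oo] --> +oo) :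
  exists G : groupType, finitely_generated G /\
    forall S : set G, finite_set S -> generates S ->
    forall mu : G -> R, simple_random_walk mu ->
      radius_ai_not_bounded S mu /\ radius_ai_preceq S mu F.
Proof.
have [N N_large] := height_function F_oo.
exists (tower N); split; first exact: tower_fg.
move=> S S_fin S_gen mu /simple_random_walkP[D mu_walk]; split.
  apply: (radius_ai_not_bounded_of_defect mu_walk S_fin S_gen) => g.
  exact: defect_tower.
move=> r' r'_ge0 [phi [phi_mono ratio_oo]] ai.
have [C C_bound] := word_length_probe S_gen.
have [rho rhoP] := lamp_size_reach D.
have phi_ge j : (j <= phi j)%N.
  by elim: j => // j IHj; apply: leq_ltn_trans IHj (phi_mono _ _ (ltnSn j)).
have phi_near (P : nat -> Prop) : (\forall n \near \oo, P n) ->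
    \forall j \near \oo, P (phi j).
  move=> [n0 _ nP]; exists n0 => // j /= n0j.
  by apply: nP; apply: leq_trans (phi_ge j).
have eps0 : 0 < 10^-1 :> R by rewrite invr_gt0.
have /cvgryPge/(_ rho.+1%:R)/phi_near F_big := F_oo.
have /cvgryPge/(_ (2 * C)%:R) r_big := ratio_oo.
have [j [[Fj rj] [V [V_mass V_inv]]]] :=
  filter_ex (filterI (filterI F_big r_big) (phi_near _ (ai _ eps0))).
move: (phi j) Fj rj V_mass V_inv => n Fn rn V_mass V_inv.
(* N k > k n >= rho n: the walk has not yet met the longest words of X_k. *)
pose k := Num.truncn (F n).
have F0 : 0 < F n by [].
have kF : k%:R <= F n by rewrite truncn_le ltW.
have Fk : F n < k.+1%:R by apply: truncnS_gt.
have rho_k : (rho <= k)%N.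
  rewrite -ltnS -(ltr_nat R) (le_lt_trans _ Fk)// (le_trans _ Fn)//.
  by rewrite ler_nat.
have reach_small h : h \in reach D n -> (size (lamp h k 0 [bseq]) < N k)%N.
  move=> hn; apply: leq_ltn_trans (rhoP n h hn k 0 _) _.
  apply: leq_ltn_trans (N_large k n Fk).
  by rewrite /= add0n mulnC leq_mul2r rho_k orbT.
have probe_short x : (word_length S (probe N x k))%:R <= r' n.
  rewrite ler_pdivlMr// in rn; apply: le_trans rn.
  apply: (@le_trans _ _ (C * k.+1)%:R); first by rewrite ler_nat.
  rewrite !natrM mulrAC [leRHS]mulrC ler_wpM2l//.
  have : 1 <= F n by apply: le_trans Fn; rewrite ler1n.
  by rewrite -natr1; lra.
have mu0 := walk_ge0 mu_walk; have D_uniq := walk_uniq mu_walk.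
have D_supp := walk_supp mu_walk; move: V_mass V_inv.
rewrite (measure_ofE mu0 D_uniq D_supp) (convolution_powerE mu0 D_uniq D_supp).
rewrite lee_fin => V_mass V_inv.
apply: (@no_invariant_mass _ _ _ _ mu_walk n (fun x => probe N x k)
  (fun x h => starts x (lamp h k 0 [bseq])) V 10^-1) => //.
- by lra.
- move=> h; set w := val _; case: w => [|y w]; first by rewrite big1.
  rewrite (bigD1 y)//= /starts /= eqxx big1 ?addr0// => x.
  by rewrite eq_sym => /negPf xy; rewrite [_ == _]xy.
- move=> x h hn nx; rewrite lampM deg_probe addr0 lamp_probe permM.
  by apply: flip_starts => //; apply: reach_small.
- move=> x h Vh; have [ph] := V_inv h (probe N x k) Vh (probe_short x).
  by rewrite ler_norml lerBrDr ler_pdivlMr// => /andP[+ _]; rewrite addrC.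
Qed.
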